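(* Let $\sigma\in\mathbb{R}$ and let $L(s)=\sum_{n=0}^\infty a_n e^{-\lambda_n s}$ be a Dirichlet series that is absolutely convergent on $\operatorname{Re}(s)=\sigma$, with $a_0=1$. Then for every $p>0$ and every $\delta>0$ $$\inf_{T\in\mathbb{R}}\left(\frac1\delta\int_T^{T+\delta}|L(\sigma+it)|^p\,dt\right)^{1/p}\ \ge\ \exp\left(-\pi\left(\frac{(\log\|L\|_1+\log2)^2}{\lambda_1\delta}+\lambda_1\delta\right)\right).$$
   Context: ''$L$ is absolutely convergent on $\operatorname{Re}(s)=\sigma$'' means: $L(s)=\sum_{n=0}^\infty a_n e^{-\lambda_n s}$ with complex coefficients $a_n$ and real exponents satisfying $0=\lambda_0<\lambda_1<\lambda_2<\cdots$, and $\|L\|_1:=\sum_{n=0}^\infty|a_n|e^{-\lambda_n\sigma}<\infty$. *)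

(* Defs.v *)
From HB Require Import structures.
From mathcomp Require Import all_boot all_order all_algebra.
From mathcomp Require Import complex.
From mathcomp Require Import all_classical all_reals all_analysis.

Set Implicit Arguments.
Unset Strict Implicit.
Unset Printing Implicit Defensive.

Import Order.TTheory GRing.Theory Num.Theory.
Import numFieldNormedType.Exports.

Local Open Scope classical_set_scope.
Local Open Scope ring_scope.
Local Open Scope complex_scope.

Definition cexp (R : realType) (z : R[i]) : R[i] :=
  (expR (complex.Re z))%:C * (cos (complex.Im z) +i* sin (complex.Im z)).

(* The norm `|z| of R[i] takes its values in R[i]; this is its real value. *)
Definition cmod (R : realType) (z : R[i]) : R := ComplexField.Normc.normc z.

Lemma cmodE (R : realType) (z : R[i]) : (cmod z)%:C = `|z|.
Proof. by []. Qed.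

Definition dirichlet_exponents (R : realType) (lambda : R^nat) : Prop :=
  lambda 0%N = 0 /\ (forall n, lambda n < lambda n.+1).

(* The sum of the series is the limit of its partial sums in R[i], for the
   topology that every numFieldType gets from its norm. *)
Definition dirichlet_series (R : realType) (a : nat -> R[i]) (lambda : R^nat)
    (s : R[i]) : R[i] :=
  limn (series (fun n => a n * cexp (- (lambda n)%:C * s))
        : nat -> (R[i] : numFieldType)).

Definition dirichlet_abs_terms (R : realType) (a : nat -> R[i])
    (lambda : R^nat) (sigma : R) : R^nat :=
  fun n => cmod (a n) * expR (- lambda n * sigma).

Definition dirichlet_abs_cvg (R : realType) (a : nat -> R[i])
    (lambda : R^nat) (sigma : R) : Prop :=
  cvgn (series (dirichlet_abs_terms a lambda sigma)).

Definition dirichlet_norm1 (R : realType) (a : nat -> R[i])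
    (lambda : R^nat) (sigma : R) : R :=
  limn (series (dirichlet_abs_terms a lambda sigma)).

(* Main.v *)
Require Import Defs.
From HB Require Import structures.
From mathcomp Require Import all_boot all_order all_algebra.
From mathcomp Require Import complex.
From mathcomp Require Import all_classical all_reals all_analysis.
From mathcomp Require Import ring lra.

Set Implicit Arguments.
Unset Strict Implicit.
Unset Printing Implicit Defensive.

Import Order.TTheory GRing.Theory Num.Theory.
Import numFieldNormedType.Exports.

Local Open Scope classical_set_scope.
Local Open Scope ring_scope.
Local Open Scope complex_scope.

(** Let [K] be the norm of [L] and [A = ln (2 K)].  The function [ln |L|] is
    subharmonic on the half-plane to the right of the line [Re s = sigma], it is
    at most [ln K] there, and at the point [sigma + h + i c] at distance
    [h = A / lambda 1] from the line it is at least [- ln 2], because the terms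
    of index [n >= 1] have shrunk there by a factor [expR (- (h * lambda n))],
    which is at most [1 / (2 K)].
    The Poisson integral of the nonnegative function [ln (K / |L|)] is therefore
    at most [A] at that point.  On an interval of length [delta] centred at [c]
    the Poisson kernel is at least [h / (pi (h ^ 2 + delta ^ 2))], so the mean of
    [ln (K / |L|)] over the interval is at most
    [pi (h / delta + delta / h) A = pi (A ^ 2 / (lambda 1 * delta) + lambda 1 * delta)].
    Jensen's inequality for [exp] turns this bound on the geometric mean into the
    bound on every power mean.

    The proof makes this argument finite in two ways.  The exponents
    [lambda n], [n < N], are rounded down to multiples of [1 / (N + 1)]: the sum
    becomes a polynomial [F] in [z = exp (- (s - sigma - i c) / (N + 1))],
    the half-plane becomes the unit disk, and the Poisson kernel becomes that of
    a circle, for which [poisson_poly] only asks for the integrals of sines and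
    cosines.  The bound for polynomials ([polynomial_mean_lower_bound]) does not
    depend on [N], and dominated convergence carries it to [L]
    ([dirichlet_line_cvg], [dirichlet_mean_lower_bound]).

    Subharmonicity of [ln |F|] is used only in the form of
    [poisson_log_series_le], which never takes the logarithm of a zero.  With
    [y = 1 - |F| ^ 2 / K ^ 2] in the unit interval, the partial sums
    [U = y + y ^ 2 / 2 + ... + y ^ M / M] are trigonometric polynomials, increase
    with [M] to [- ln (|F| ^ 2 / K ^ 2)], and satisfy [|F| ^ 2 * expR U <= K ^ 2].
    Writing [U] as the real part of a polynomial [g] on the circle, the maximum
    principle for [F * expR (g / 2)] gives
    [|F r| ^ 2 * expR (Re (g r)) <= K ^ 2], and [Re (g r)] is the Poisson integral
    of [U].  Letting [M] grow only after integrating over the interval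
    ([log_series_dini]) recovers the bound on [ln (K / |F|)]. *)

(** * Integrals of continuous functions over segments *)

Section Integral.
Context {R : realType}.
Notation mu := (@lebesgue_measure R).
Implicit Types (f F : R -> R) (a b : R).

Lemma continuous_itv_integrable a b f : continuous f ->
  mu.-integrable `[a, b] (EFin \o f).
Proof.
move=> cf; apply: continuous_compact_integrable; first exact: segment_compact.
exact: continuous_subspaceT.
Qed.

Lemma le_Rintegral_subset a b a' b' f : continuous f -> (forall t, 0 <= f t) ->
  a <= a' -> b' <= b ->
  \int[mu]_(t in `[a', b']) f t <= \int[mu]_(t in `[a, b]) f t.
Proof.
move=> cf f0 aa bb; rewrite /Rintegral fine_le//.
- exact: integrable_fin_num (continuous_itv_integrable _ _ cf).
- exact: integrable_fin_num (continuous_itv_integrable _ _ cf).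
apply: ge0_subset_integral => //.
- exact: (measurable_int _ (continuous_itv_integrable _ _ cf)).
- by move=> t _; rewrite lee_fin.
- by apply: subset_itv; rewrite bnd_simp.
Qed.

Lemma Rintegral_cst_itv a b (k : R) : a <= b ->
  \int[mu]_(t in `[a, b]) k = k * (b - a).
Proof.
move=> ab; rewrite Rintegral_cst//; congr (_ * _).
rewrite /= lebesgue_measure_itv/=; case: ifPn => //=.
rewrite lte_fin -leNgt => ba.
by rewrite (@le_anti _ _ a b) ?ab ?ba// subrr.
Qed.

Lemma Rintegral_antiderivative a b f F : a < b -> continuous f ->
  (forall x : R, is_derive x (1 : R) F (f x)) -> F a = F b ->
  \int[mu]_(t in `[a, b]) f t = 0.
Proof.
move=> ab cf dF Fab.
have cF x : F y @[y --> x] --> F x.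
  by apply/differentiable_continuous/derivable1_diffP; case: (dF x).
rewrite /Rintegral (@continuous_FTC2 _ f F)//.
- by rewrite Fab subee.
- exact: continuous_subspaceT.
- split => //.
  + exact: cvg_at_right_filter.
  + exact: cvg_at_left_filter.
- by move=> x _; rewrite derive1E; case: (dF x).
Qed.

End Integral.

(** * The Poisson kernel on a circle of arbitrary length *)

Section Poisson.
Context {R : realType}.
Notation mu := (@lebesgue_measure R).
Implicit Types (u v : R -> R) (H : {poly R[i]}).

(** The characteristic roots are [r] and [1 / r], and boundedness excludes the
    second: [D n = X n.+1 - r * X n] satisfies [D n = r ^+ m * D (n + m)], which
    tends to [0]. *)
Lemma bounded_geometric_recurrence (X : R^nat) (r C : R) : 0 < r < 1 ->
  (forall n, (1 + r ^+ 2) * X n.+1 = r * (X n.+2 + X n)) ->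
  (forall n, `|X n| <= C) -> forall n, X n = r ^+ n * X 0%N.
Proof.
move=> /andP[r0 r1] rec bd.
pose D n := X n.+1 - r * X n.
have DS n : D n = r * D n.+1 by rewrite /D; have := rec n; lra.
have DD n m : D n = r ^+ m * D (n + m)%N.
  elim: m => [|m IH]; first by rewrite addn0 expr0 mul1r.
  by rewrite IH (DS (n + m)%N) addnS exprSr mulrA.
have D0 n : D n = 0.
  apply/normr0_eq0/le_anti; rewrite normr_ge0 andbT.
  have DC m : `|D m| <= C + C.
    rewrite (le_trans (ler_normB _ _))// lerD// normrM gtr0_norm//.
    by rewrite (le_trans _ (bd m))// ler_piMl// ltW.
  have lim0 : (fun m => r ^+ m * (C + C)) @ \oo --> 0.
    rewrite -[X in _ --> X](mul0r (C + C)); apply: cvgM; last exact: cvg_cst.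
    by apply: cvg_expr; rewrite gtr0_norm.
  apply: (cvgr_to_ge lim0); apply: nearW => m /=.
  by rewrite (DD n m) normrM normrX gtr0_norm// ler_wpM2l// exprn_ge0// ltW.
elim=> [|n IH]; first by rewrite expr0 mul1r.
have /eqP := D0 n; rewrite subr_eq0 => /eqP ->.
by rewrite IH exprS mulrA.
Qed.

(** The point [exp (- i w (t - c))], which runs once around the unit circle when
    [t] runs over an interval of length [2 pi / w] centred at [c]. *)
Definition circle_param (w c t : R) : R[i] := cos (w * (t - c)) +i* (- sin (w * (t - c))).

Lemma circle_paramX w c t n : circle_param w c t ^+ n =
  cos (n%:R * (w * (t - c))) +i* (- sin (n%:R * (w * (t - c)))).
Proof.
elim: n => [|n IH]; first by rewrite expr0 mul0r cos0 sin0 oppr0.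
rewrite exprS IH /circle_param -natr1 mulrDl mul1r addrC cosD sinD.
by apply/eqP; rewrite eq_complex/=; apply/andP; split; apply/eqP; ring.
Qed.

Lemma circle_paramJ w c t : circle_param w c t * (circle_param w c t)^* = 1.
Proof.
rewrite /circle_param; apply/eqP; rewrite eq_complex/=; apply/andP; split; apply/eqP.
- by rewrite -[RHS](cos2Dsin2 (w * (t - c))); ring.
- by ring.
Qed.

Lemma continuous_phase n w c : continuous (fun t : R => n%:R * (w * (t - c))).
Proof.
move=> t; apply: cvgM; first exact: cvg_cst.
apply: cvgM; first exact: cvg_cst.
apply: cvgB; [exact: cvg_id|exact: cvg_cst].
Qed.

Lemma continuous_cos_phase n w c : continuous (fun t : R => cos (n%:R * (w * (t - c)))).
Proof.
move=> t; apply: (@continuous_comp _ _ _ (fun t => n%:R * (w * (t - c))) cos).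
  exact: continuous_phase.
exact: continuous_cos.
Qed.

Lemma continuous_sin_phase n w c : continuous (fun t : R => sin (n%:R * (w * (t - c)))).
Proof.
move=> t; apply: (@continuous_comp _ _ _ (fun t => n%:R * (w * (t - c))) sin).
  exact: continuous_phase.
exact: continuous_sin.
Qed.

Context (w c r : R) (w0 : 0 < w) (r01 : 0 < r < 1).
Let a := c - pi / w.
Let b := c + pi / w.

Let ab : a < b.
Proof. have : 0 < pi / w by rewrite divr_gt0// pi_gt0.
rewrite /a /b; lra. Qed.

Let wa : w * (a - c) = - pi.
Proof. by rewrite /a; field; rewrite gt_eqF. Qed.
Let wb : w * (b - c) = pi.
Proof. by rewrite /b; field; rewrite gt_eqF. Qed.

Lemma sin_natpi n : sin (n%:R * pi) = 0 :> R.
Proof.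
elim: n => [|n IH]; first by rewrite mul0r sin0.
by rewrite -natr1 mulrDl mul1r sinDpi IH oppr0.
Qed.

Lemma Rintegral_cos_phase n : (0 < n)%N ->
  \int[mu]_(t in `[a, b]) cos (n%:R * (w * (t - c))) = 0.
Proof.
move=> n0; have [wn nn] : w != 0 /\ n%:R != 0 :> R by rewrite gt_eqF// pnatr_eq0 -lt0n.
apply: (@Rintegral_antiderivative _ _ _ _ (fun t => (n%:R * w)^-1 * sin (n%:R * (w * (t - c))))) => //.
- exact: continuous_cos_phase.
- move=> x; apply: is_derive_eq; rewrite /GRing.scale/=; field.
  by rewrite wn nn.
- by rewrite wa wb mulrN sinN sin_natpi oppr0.
Qed.

Lemma Rintegral_sin_phase n : (0 < n)%N ->
  \int[mu]_(t in `[a, b]) sin (n%:R * (w * (t - c))) = 0.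
Proof.
move=> n0; have [wn nn] : w != 0 /\ n%:R != 0 :> R by rewrite gt_eqF// pnatr_eq0 -lt0n.
apply: (@Rintegral_antiderivative _ _ _ _ (fun t => - (n%:R * w)^-1 * cos (n%:R * (w * (t - c))))) => //.
- exact: continuous_sin_phase.
- move=> x; apply: is_derive_eq; rewrite /GRing.scale/=; field.
  by rewrite wn nn.
- by rewrite wa wb mulrN cosN.
Qed.

Definition poisson_kernel (t : R) := (1 - r ^+ 2) / (1 - 2 * r * cos (w * (t - c)) + r ^+ 2).

Lemma poisson_kernel_den_gt0 t : 0 < 1 - 2 * r * cos (w * (t - c)) + r ^+ 2.
Proof.
have [r0 r1] := andP r01.
have : 0 <= r * (1 - cos (w * (t - c))).
  by rewrite mulr_ge0 ?(ltW r0)// subr_ge0 cos_le1.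
have : 0 < (1 - r) ^+ 2 by rewrite exprn_gt0// subr_gt0.
nra.
Qed.

Lemma poisson_kernel_ge0 t : 0 <= poisson_kernel t.
Proof.
have [r0 r1] := andP r01.
rewrite divr_ge0 ?(ltW (poisson_kernel_den_gt0 _))//; nra.
Qed.

Lemma continuous_poisson_kernel : continuous poisson_kernel.
Proof.
move=> t; apply: cvgM; first exact: cvg_cst.
apply: cvgV; first by rewrite gt_eqF// poisson_kernel_den_gt0.
apply: cvgD; last exact: cvg_cst.
apply: cvgB; first exact: cvg_cst.
apply: cvgM; first exact: cvg_cst.
have := @continuous_cos_phase 1 w c t; rewrite /continuous_at mul1r.
by under eq_fun do rewrite mul1r.
Qed.

Definition poisson u := w / (2 * pi) * \int[mu]_(t in `[a, b]) (poisson_kernel t * u t).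

Let ipk u : continuous u -> mu.-integrable `[a, b] (EFin \o (fun t => poisson_kernel t * u t)).
Proof.
move=> cu; apply: continuous_itv_integrable => t.
by apply: cvgM; [exact: continuous_poisson_kernel|exact: cu].
Qed.

Let w2pi : 0 < w / (2 * pi).
Proof. by rewrite divr_gt0// mulr_gt0// pi_gt0. Qed.

Lemma poissonD u v : continuous u -> continuous v ->
  poisson (fun t => u t + v t) = poisson u + poisson v.
Proof.
move=> cu cv; rewrite /poisson -mulrDr; congr (_ * _).
by under eq_Rintegral do rewrite mulrDr; rewrite RintegralD//; exact: ipk.
Qed.

Lemma poissonZ k u : continuous u ->
  poisson (fun t => k * u t) = k * poisson u.
Proof.
move=> cu; rewrite /poisson mulrCA; congr (_ * _).
by under eq_Rintegral do rewrite mulrCA; rewrite RintegralZl//; exact: ipk.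
Qed.

Lemma ler_poisson u v : continuous u -> continuous v ->
  (forall t, u t <= v t) -> poisson u <= poisson v.
Proof.
move=> cu cv uv; rewrite /poisson ler_pM2l//; apply: le_Rintegral => //.
- exact: ipk.
- exact: ipk.
- by move=> t _; rewrite ler_wpM2l// poisson_kernel_ge0.
Qed.

Let poisson_bounded u : continuous u -> (forall t, `|u t| <= 1) ->
  `|poisson u| <= poisson (cst 1).
Proof.
move=> cu u1; have c1 : continuous (cst 1 : R -> R) by move=> t; exact: cvg_cst.
rewrite ler_norml; apply/andP; split.
  rewrite -mulN1r -poissonZ//; apply: ler_poisson => //.
    by move=> t; apply: cvgM; exact: cvg_cst.
  by move=> t /=; rewrite mulr1; have := u1 t; rewrite ler_norml => /andP[].
by apply: ler_poisson => // t /=; have := u1 t; rewrite ler_norml => /andP[].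
Qed.

Let poisson_rec (u0 u1 u2 : R -> R) : continuous u0 -> continuous u1 -> continuous u2 ->
  (forall t, u2 t + u0 t = 2 * cos (w * (t - c)) * u1 t) ->
  (1 + r ^+ 2) * poisson u1 - r * (poisson u2 + poisson u0) =
  (1 - r ^+ 2) * (w / (2 * pi) * \int[mu]_(t in `[a, b]) u1 t).
Proof.
move=> c0 c1 c2 e.
have c20 : continuous (fun t => u2 t + u0 t).
  by move=> t; apply: cvgD; [exact: c2|exact: c0].
have cZ k u : continuous u -> continuous (fun t => k * u t).
  by move=> cu t; apply: cvgM; [exact: cvg_cst|exact: cu].
have c3 := cZ r _ c20.
rewrite -mulN1r -(poissonD c2 c0) -(poissonZ _ c1) -(poissonZ _ c20).
rewrite -(poissonZ _ c3) -(poissonD (cZ _ _ c1) (cZ _ _ c3)).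
rewrite /poisson [RHS]mulrCA; congr (_ * _).
rewrite -RintegralZl//; last exact: continuous_itv_integrable.
apply: eq_Rintegral => t _; rewrite e /poisson_kernel; field.
by rewrite gt_eqF// poisson_kernel_den_gt0.
Qed.

Let cosS (n : nat) (x : R) :
  cos (n.+2%:R * x) + cos (n%:R * x) = 2 * cos x * cos (n.+1%:R * x).
Proof.
have -> : n.+2%:R * x = n.+1%:R * x + x by rewrite -natr1; ring.
have -> : n%:R * x = n.+1%:R * x - x by rewrite -(natr1 n); ring.
by rewrite cosD cosB; ring.
Qed.

Let sinS (n : nat) (x : R) :
  sin (n.+2%:R * x) + sin (n%:R * x) = 2 * cos x * sin (n.+1%:R * x).
Proof.
have -> : n.+2%:R * x = n.+1%:R * x + x by rewrite -natr1; ring.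
have -> : n%:R * x = n.+1%:R * x - x by rewrite -(natr1 n); ring.
by rewrite sinD sinB; ring.
Qed.

(** Multiplying the kernel by its denominator leaves a constant, so the moments
    [X n] of the kernel against [sin (n x)] or [cos (n x)] satisfy [(1 + r ^+ 2)
    * X n.+1 = r * (X n.+2 + X n)], where the constant integrates to [0] against
    the middle harmonic. *)
Lemma poisson_sin n : poisson (fun t => sin (n%:R * (w * (t - c)))) = 0.
Proof.
rewrite (@bounded_geometric_recurrence
  (fun n => poisson (fun t => sin (n%:R * (w * (t - c))))) r (poisson (cst 1)) r01).
- rewrite /poisson; under eq_Rintegral do rewrite mul0r sin0 mulr0.
  by rewrite Rintegral_cst// mul0r !mulr0.
- move=> m; apply/eqP; rewrite -subr_eq0 poisson_rec.
  + by rewrite Rintegral_sin_phase// !mulr0.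
  + exact: continuous_sin_phase.
  + exact: continuous_sin_phase.
  + exact: continuous_sin_phase.
  + by move=> t; rewrite sinS.
- by move=> m; apply: poisson_bounded => [|t]; [exact: continuous_sin_phase|exact: sin_max].
Qed.

Lemma poisson_cos n : poisson (fun t => cos (n%:R * (w * (t - c)))) = r ^+ n.
Proof.
have [r0 r1] := andP r01.
pose X n := poisson (fun t => cos (n%:R * (w * (t - c)))).
have geo : forall n, X n = r ^+ n * X 0%N.
  apply: (@bounded_geometric_recurrence _ _ (poisson (cst 1)) r01).
  - move=> m; apply/eqP; rewrite -subr_eq0 poisson_rec.
    + by rewrite Rintegral_cos_phase// !mulr0.
    + exact: continuous_cos_phase.
    + exact: continuous_cos_phase.
    + exact: continuous_cos_phase.
    + by move=> t; rewrite cosS.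
  - by move=> m; apply: poisson_bounded => [|t]; [exact: continuous_cos_phase|exact: cos_max].
suff X0 : X 0%N = 1 by have := geo n; rewrite X0 mulr1.
(* The recurrence at index [0], where both neighbours are [X 1] because the
   cosine is even, and where the integral of the constant does not vanish. *)
have : (1 + r ^+ 2) * X 0%N - r * (X 1%N + X 1%N) = 1 - r ^+ 2.
  rewrite poisson_rec; last first.
  - by move=> t; rewrite mul0r mul1r cos0; ring.
  - exact: continuous_cos_phase.
  - exact: continuous_cos_phase.
  - exact: continuous_cos_phase.
  under eq_Rintegral do rewrite mul0r cos0.
  rewrite Rintegral_cst_itv ?ltW// /a /b.
  move: (pi : R) (pi_gt0 R) => q q0; field.
  by rewrite !gt_eqF.
have := geo 1%N; rewrite expr1 => -> E.
apply: (@mulfI _ (1 - r ^+ 2)); first by rewrite gt_eqF//; nra.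
rewrite mulr1 -[RHS]E; ring.
Qed.

End Poisson.

(** * Moduli of complex numbers *)

Section Cmod.
Context {R : realType}.
Implicit Types (x y z : R[i]).

Lemma cmod_ge0 z : 0 <= cmod z.
Proof. by case: z => a b; rewrite sqrtr_ge0. Qed.

Lemma cmodM x y : cmod (x * y) = cmod x * cmod y.
Proof. exact: ComplexField.Normc.normcM. Qed.

Lemma ler_cmodD x y : cmod (x + y) <= cmod x + cmod y.
Proof. exact: le_normcD. Qed.

Lemma cmodN x : cmod (- x) = cmod x.
Proof. exact: normcN. Qed.

Lemma cmod1 : cmod (1 : R[i]) = 1.
Proof. exact: ComplexField.Normc.normc1. Qed.

Lemma cmod0 : cmod (0 : R[i]) = 0.
Proof. exact: ComplexField.Normc.normc0. Qed.

Lemma cmod_eq0 z : (cmod z == 0) = (z == 0).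
Proof.
apply/eqP/eqP => [|->]; last exact: cmod0.
exact: ComplexField.Normc.eq0_normc.
Qed.

Lemma cmodX x n : cmod (x ^+ n) = cmod x ^+ n.
Proof.
elim: n => [|n IH]; first by rewrite !expr0 cmod1.
by rewrite !exprS cmodM IH.
Qed.

Lemma sqr_cmod z : cmod z ^+ 2 = complex.Re z ^+ 2 + complex.Im z ^+ 2.
Proof.
by case: z => a b; rewrite /cmod/= sqr_sqrtr// addr_ge0// sqr_ge0.
Qed.

Lemma cmod_real (a : R) : cmod a%:C = `|a|.
Proof. by rewrite /cmod/= expr0n/= addr0 sqrtr_sqr. Qed.

Lemma cmodJ z : cmod z^* = cmod z.
Proof. by case: z => a b; rewrite /cmod/= sqrrN. Qed.

Lemma Re_le_cmod z : `|complex.Re z| <= cmod z.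
Proof.
case: z => a b; rewrite /cmod/= -(sqrtr_sqr a) ler_wsqrtr//.
by rewrite lerDl sqr_ge0.
Qed.

Lemma Im_le_cmod z : `|complex.Im z| <= cmod z.
Proof.
case: z => a b; rewrite /cmod/= -(sqrtr_sqr b) ler_wsqrtr//.
by rewrite lerDr sqr_ge0.
Qed.

Lemma cmod_le_ReIm z : cmod z <= `|complex.Re z| + `|complex.Im z|.
Proof.
rewrite -(@ler_pXn2r _ 2)// ?nnegrE ?addr_ge0 ?cmod_ge0//.
rewrite sqr_cmod sqrrD -(real_normK (num_real (complex.Re z))).
rewrite -(real_normK (num_real (complex.Im z))).
by rewrite lerD2r lerDl mulrn_wge0// mulr_ge0.
Qed.

Lemma ler_cmod_sum (I : Type) (s : seq I) (P : pred I) (F : I -> R[i]) :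
  cmod (\sum_(i <- s | P i) F i) <= \sum_(i <- s | P i) cmod (F i).
Proof.
elim/big_ind2: _ => [|x1 x2 y1 y2 h1 h2|//]; first by rewrite cmod0.
by rewrite (le_trans (ler_cmodD _ _))// lerD.
Qed.

(** The rotation that makes a complex number real lets bounds on real parts
    control moduli. *)
Lemma cmod_unit_multiple z : exists2 e : R[i], cmod e = 1 & e * z = (cmod z)%:C.
Proof.
have [->|z0] := eqVneq z 0; first by exists 1; rewrite ?cmod1// mulr0 cmod0.
have m0 : cmod z != 0 by rewrite cmod_eq0.
exists (z^* * (cmod z)^-1%:C).
  by rewrite cmodM cmodJ cmod_real ger0_norm ?invr_ge0 ?cmod_ge0// divff.
apply: (@mulIf _ (cmod z)%:C); first by rewrite -cmod_eq0 cmod_real normr_eq0.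
have mm : (cmod z)^-1%:C * (cmod z)%:C = 1 by rewrite -rmorphM/= mulVf.
rewrite mulrAC -(mulrA _ _ (cmod z)%:C) mm mulr1.
case: z {z0 m0 mm} => a b; rewrite -rmorphM -expr2 sqr_cmod/=.
by apply/eqP; rewrite eq_complex/=; apply/andP; split; apply/eqP; ring.
Qed.

Lemma cmod_circle_param (w c t : R) : cmod (circle_param w c t) = 1.
Proof.
apply: (@pexpIrn _ 2); rewrite ?nnegrE ?cmod_ge0//.
by rewrite sqr_cmod/= sqrrN cos2Dsin2 expr1n.
Qed.

End Cmod.

(** * Trigonometric polynomials *)

Section TrigPoly.
Context {R : realType} (w c : R).
Notation e := (circle_param w c).
Implicit Types (u v : R -> R) (g h H : {poly R[i]}).

Let ReD (x y : R[i]) : complex.Re (x + y) = complex.Re x + complex.Re y.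
Proof. by case: x => ? ?; case: y. Qed.

Lemma continuous_Re_monomial (k : R[i]) n : continuous (fun t => complex.Re (k * e t ^+ n)).
Proof.
case: k => x y; under eq_fun do rewrite circle_paramX /= mulrN opprK.
move=> t; apply: cvgD.
  by apply: cvgM; [exact: cvg_cst|exact: continuous_cos_phase].
by apply: cvgM; [exact: cvg_cst|exact: continuous_sin_phase].
Qed.


Lemma continuous_trigpoly H : continuous (fun t => complex.Re H.[e t]).
Proof.
suff : forall n, continuous (fun t => complex.Re (H.[e t] * e t ^+ n)).
  by move=> /(_ 0%N); under eq_fun do rewrite expr0 mulr1.
elim/poly_ind: H => [|p k IH] n.
  by under eq_fun do rewrite horner0 mul0r; move=> t; exact: cvg_cst.
under eq_fun do rewrite hornerD hornerM hornerX hornerC mulrDl -mulrA -exprS ReD.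
by move=> t; apply: cvgD; [exact: IH|exact: continuous_Re_monomial].
Qed.

(** Conjugates of monomials have the same real parts as monomials with conjugate
    coefficients, so real parts of polynomials already exhaust the real
    trigonometric polynomials, and the class is closed under products. *)
Definition trigpoly u := exists H, forall t, u t = complex.Re H.[e t].

Lemma trigpoly_continuous u : trigpoly u -> continuous u.
Proof.
move=> [H uH]; have -> : u = (fun t => complex.Re H.[e t]) by exact/funext.
exact: continuous_trigpoly.
Qed.

Lemma trigpolyD u v : trigpoly u -> trigpoly v -> trigpoly (fun t => u t + v t).
Proof. by move=> [g ug] [h vh]; exists (g + h) => t; rewrite ug vh hornerD ReD. Qed.

Lemma trigpoly_cst k : trigpoly (fun=> k).
Proof. by exists k%:C%:P => t; rewrite hornerC. Qed.

Let trigpoly_conjX g n (k : R[i]) :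
  trigpoly (fun t => complex.Re (k * g.[e t] * (e t)^* ^+ n)).
Proof.
elim/poly_ind: g n => [|p l IH] n.
  by exists 0 => t; rewrite !horner0 mulr0 mul0r.
have tl : trigpoly (fun t => complex.Re (k * l * (e t)^* ^+ n)).
  exists ((k * l)^*%:P * 'X^n) => t; rewrite hornerCM hornerXn.
  by rewrite -rmorphXn; case: (k * l) => a b; case: (e t ^+ n) => ? ? /=; ring.
case: n tl => [|n] tl.
  by exists (k%:P * (p * 'X + l%:P)) => t; rewrite expr0 mulr1 hornerCM.
have [H uH] := trigpolyD (IH n) tl; exists H => t; rewrite -uH -ReD.
rewrite hornerD hornerM hornerX hornerC exprS; congr complex.Re.
have := circle_paramJ w c t; set x := e t; set y := x^* => xy.
by rewrite mulrDr mulrDl; congr (_ + _); rewrite !mulrA -(mulrA _ x) xy mulr1.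
Qed.

(** On the circle the conjugate of [z] is its inverse, so [z ^+ m * (z ^+ n)^*]
    is a power of [z] or the conjugate of one. *)
Lemma trigpoly_mul_conj g h : trigpoly (fun t => complex.Re (g.[e t] * h.[e t]^*)).
Proof.
suff : forall n, trigpoly (fun t => complex.Re (g.[e t] * (h.[e t] * e t ^+ n)^*)).
  by move=> /(_ 0%N) [H uH]; exists H => t; rewrite -uH expr0 mulr1.
elim/poly_ind: h => [|p k IH] n.
  by exists 0 => t; rewrite !horner0 mul0r rmorph0 mulr0.
have [H uH] := trigpolyD (IH n.+1) (trigpoly_conjX g n k^*).
exists H => t; rewrite -uH -ReD hornerD hornerM hornerX hornerC; congr complex.Re.
rewrite mulrDl rmorphD mulrDr exprS mulrA; congr (_ + _).
by rewrite rmorphM rmorphXn/= mulrA (mulrC k^*).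
Qed.

(** [2 * Re u * Re v] is the real part of [u * v] plus that of [u * v^* ]. *)
Lemma trigpolyM u v : trigpoly u -> trigpoly v -> trigpoly (fun t => u t * v t).
Proof.
move=> [g ug] [h vh].
have [H uH] := trigpoly_mul_conj g h.
exists (2^-1%:C%:P * (g * h + H)) => t.
rewrite hornerCM hornerD hornerM ug vh.
have := uH t; case: g.[e t] => a b; case: h.[e t] => a' b'; case: H.[e t] => x y /=.
by move=> <-; field.
Qed.

Lemma trigpoly_sqr_cmod g : trigpoly (fun t => cmod g.[e t] ^+ 2).
Proof.
have [H uH] := trigpoly_mul_conj g g.
by exists H => t; rewrite -uH sqr_cmod; case: g.[e t] => a b /=; ring.
Qed.

Lemma trigpolyX u n : trigpoly u -> trigpoly (fun t => u t ^+ n).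
Proof.
move=> tu; elim: n => [|n IH]; first exact: trigpoly_cst.
by under eq_fun do rewrite exprS; exact: trigpolyM.
Qed.

Context (r : R) (w0 : 0 < w) (r01 : 0 < r < 1).

(** Harmonicity of the real part of a polynomial; by linearity it reduces to the
    moments of the kernel. *)
Lemma poisson_poly H : poisson w c r (fun t => complex.Re H.[e t]) = complex.Re H.[r%:C].
Proof.
suff : forall n, poisson w c r (fun t => complex.Re (H.[e t] * e t ^+ n)) =
    complex.Re (H.[r%:C] * r%:C ^+ n).
  move=> /(_ 0%N); rewrite expr0 mulr1 => <-.
  by congr poisson; apply/funext => t; rewrite expr0 mulr1.
elim/poly_ind: H => [|p k IH] n.
  under [X in poisson _ _ _ X]eq_fun do rewrite horner0 mul0r.
  rewrite horner0 mul0r /poisson; under eq_Rintegral do rewrite mulr0.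
  by rewrite Rintegral_cst// mul0r mulr0.
under [X in poisson _ _ _ X]eq_fun
  do rewrite hornerD hornerM hornerX hornerC mulrDl -mulrA -exprS ReD.
have cp m : continuous (fun t => complex.Re (p.[e t] * e t ^+ m)).
  have := @continuous_trigpoly (p * 'X^m).
  by under eq_fun do rewrite hornerM hornerXn.
rewrite poissonD//; last exact: continuous_Re_monomial.
rewrite IH hornerD hornerM hornerX hornerC mulrDl -mulrA -exprS ReD; congr (_ + _).
case: k => a b; under [X in poisson _ _ _ X]eq_fun do rewrite circle_paramX /= mulrN opprK.
rewrite poissonD//; last 2 first.
- by move=> t; apply: cvgM; [exact: cvg_cst|exact: continuous_cos_phase].
- by move=> t; apply: cvgM; [exact: cvg_cst|exact: continuous_sin_phase].
rewrite poissonZ//; last exact: continuous_cos_phase.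
rewrite poissonZ//; last exact: continuous_sin_phase.
by rewrite poisson_cos// poisson_sin// mulr0 addr0 -rmorphXn/= mulr0 subr0.
Qed.

Lemma poisson_cst1 : poisson w c r (cst 1) = 1.
Proof.
by have := poisson_poly 1; under eq_fun do rewrite hornerE; rewrite hornerE.
Qed.

(** After a rotation the modulus at [r] is a real part, hence an average of real
    parts over the circle against a probability density. *)
Lemma disk_maximum_modulus H (B : R) : (forall t, cmod H.[e t] <= B) ->
  cmod H.[r%:C] <= B.
Proof.
move=> HB; have [k k1 kH] := cmod_unit_multiple H.[r%:C].
have -> : cmod H.[r%:C] = complex.Re (k%:P * H).[r%:C] by rewrite hornerCM kH.
have c1 : continuous (cst 1 : R -> R) by move=> t; exact: cvg_cst.
rewrite -poisson_poly -[leRHS]mulr1 -poisson_cst1 -(poissonZ _ _ r01)//.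
apply: ler_poisson => //.
- exact: continuous_trigpoly.
- by move=> t; apply: cvgM; exact: cvg_cst.
move=> t; rewrite mulr1 hornerCM (le_trans (ler_norm _))//.
by rewrite (le_trans (Re_le_cmod _))// cmodM k1 mul1r.
Qed.

Lemma circle_horner_bounded H : exists C : R, forall t, cmod H.[e t] <= C.
Proof.
elim/poly_ind: H => [|p k [C hC]]; first by exists 0 => t; rewrite horner0 cmod0.
exists (C + cmod k) => t; rewrite hornerD hornerM hornerX hornerC.
by rewrite (le_trans (ler_cmodD _ _))// lerD2r cmodM cmod_circle_param mulr1.
Qed.

End TrigPoly.

(** * The logarithmic series *)

Section LogSeries.
Context {R : realType}.
Implicit Types (x y : R) (M : nat).

(** Partial sums of [- ln (1 - y)]. *)
Definition log_series M y : R := \sum_(k < M) y ^+ k.+1 / k.+1%:R.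

Lemma log_series_S M : log_series M.+1 =
  (fun y => log_series M y + y ^+ M.+1 / M.+1%:R).
Proof. by apply/funext => y; rewrite /log_series big_ord_recr. Qed.

Lemma log_series0 M : log_series M 0 = 0.
Proof. by apply: big1 => k _; rewrite expr0n mul0r. Qed.

Lemma log_series_ge0 M y : 0 <= y -> 0 <= log_series M y.
Proof. by move=> y0; apply: sumr_ge0 => k _; rewrite divr_ge0// exprn_ge0. Qed.

Lemma ler_log_series M x y : 0 <= x -> x <= y -> log_series M x <= log_series M y.
Proof.
move=> x0 xy; apply: ler_sum => k _; rewrite ler_wpM2r ?invr_ge0//.
by rewrite lerXn2r ?nnegrE// (le_trans x0).
Qed.

Lemma is_derive_log_series M x :
  is_derive x (1 : R) (log_series M) (\sum_(k < M) x ^+ k).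
Proof.
elim: M => [|M IH].
  rewrite big_ord0; have -> : log_series 0 = cst 0.
    by apply/funext => y; rewrite /log_series big_ord0.
  exact: is_derive_cst.
rewrite log_series_S big_ord_recr/=.
have -> : (fun y => log_series M y + y ^+ M.+1 / M.+1%:R) =
    log_series M + M.+1%:R^-1 *: ((@id R) ^+ M.+1).
  apply/funext => y; rewrite [RHS]/GRing.add/= /GRing.scale/= mulrC.
  by rewrite exprfctE.
by apply: is_deriveD; apply: is_derive_eq; rewrite /GRing.scale/= mulr1 mulKf.
Qed.

Lemma geometric_sum M y : (1 - y) * \sum_(k < M) y ^+ k = 1 - y ^+ M.
Proof. by rewrite -opprB mulNr -subrX1 opprB. Qed.

(** The left-hand side is [1] at [y = 0], and its derivative telescopes to [- y
    ^+ M * expR (log_series M y)]. At [y = 1], where the logarithm is infinite,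
    the inequality still makes sense. *)
Lemma log_series_upper M y : 0 <= y <= 1 -> (1 - y) * expR (log_series M y) <= 1.
Proof.
move=> /andP[y0 y1].
pose f z := (1 - z) * expR (log_series M z).
pose df z := - (z ^+ M * expR (log_series M z)).
have der x : is_derive x (1 : R) f (df x).
  have := is_derive_log_series M x => ?; apply: is_derive_eq.
  rewrite /GRing.scale/= /df -[X in _ = - (X * _)]opprK -[in RHS](subKr 1 (x ^+ M)) -geometric_sum.
  by ring.
have cf x : {for x, continuous f}.
  by apply/differentiable_continuous/derivable1_diffP; case: (der x).
have [|z] := @MVT_segment R f df 0 y y0 (fun x _ => der x).
  exact: continuous_subspaceT.
rewrite in_itv/= => /andP[z0 zy] E.
have : f y - f 0 <= 0.
  by rewrite E subr0 mulNr oppr_le0 !mulr_ge0 ?expR_ge0// exprn_ge0.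
by rewrite {2}/f log_series0 expR0 subr0 mulr1 subr_le0.
Qed.

(** The derivative of [log_series M z + ln (1 - z)] is [- z ^+ M / (1 - z)],
    which is at least [- x ^+ M / (1 - x)] on the segment from [0] to [x]. *)
Lemma log_series_lower M x y : 0 <= y <= x -> x < 1 ->
  - ln (1 - y) <= log_series M y + x ^+ M / (1 - x).
Proof.
move=> /andP[y0 yx] x1; set C := _ / _.
have C0 : 0 <= C by rewrite divr_ge0 ?exprn_ge0 ?(le_trans y0 yx)// subr_ge0 ltW.
pose f z := log_series M z + C * z + ln (1 - z).
pose df z := \sum_(k < M) z ^+ k + C - (1 - z)^-1.
have der (z : R) : z < 1 -> is_derive z (1 : R) f (df z).
  move=> z1; have := is_derive_log_series M z => ?.
  have ? : is_derive z (1 : R) (fun t => ln (1 - t)) (- (1 - z)^-1).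
    have z1' : 0 < 1 - z by rewrite subr_gt0.
    have := @is_derive1_ln R (1 - z) z1' => ?.
    have ? : is_derive z (1 : R) (fun t : R => 1 - t) (-1).
      by apply: is_derive_eq; rewrite add0r mul1r.
    by apply: is_derive_eq; rewrite /GRing.scale/=; ring.
  apply: is_derive_eq; rewrite /df /GRing.scale/=; ring.
have dery (z : R) : z \in `]0, y[ -> is_derive z (1 : R) f (df z).
  rewrite in_itv/= => /andP[_ zy]; apply: der.
  by rewrite (lt_trans zy)// (le_lt_trans yx).
have [|z] := @MVT_segment R f df 0 y y0 dery.
  apply: derivable_within_continuous => z; rewrite in_itv/= => /andP[_ zy].
  have z1 : z < 1 by rewrite (le_lt_trans zy)// (le_lt_trans yx).
  by case: (der z z1).
rewrite in_itv/= => /andP[z0 zy] E.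
have z1 : z < 1 by rewrite (le_lt_trans zy)// (le_lt_trans yx).
have zx : z <= x by rewrite (le_trans zy).
have d0 : 0 <= df z.
  have z1' : 0 < 1 - z by rewrite subr_gt0.
  have -> : df z = C - z ^+ M / (1 - z).
    rewrite /df -[X in X + C](mulKf (lt0r_neq0 z1')) geometric_sum; field.
    by rewrite lt0r_neq0.
  rewrite subr_ge0 ler_pM ?exprn_ge0 ?invr_ge0 ?(ltW z1')//.
    by rewrite lerXn2r ?nnegrE// (le_trans y0).
  by rewrite lef_pV2 ?posrE ?subr_gt0// lerD2l lerN2.
have : 0 <= f y - f 0 by rewrite E subr0 mulr_ge0.
rewrite {2}/f log_series0 mulr0 subr0 ln1 !addr0 subr0 /f => h.
have : C * y <= C by rewrite ler_piMr// (le_trans yx)// ltW.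
by lra.
Qed.

(** A quantity bounded both by [- ln (1 - y)] and by a constant [C] is reached,
    up to [eps], by the same partial sum for all [y]: beyond the point where [-
    ln (1 - y) = C], monotonicity of the partial sums takes over from the
    estimate of the tail. *)
Lemma log_series_dini (C eps : R) : 0 <= C -> 0 < eps ->
  exists M, forall y v, 0 <= y <= 1 -> v <= C -> (y < 1 -> v <= - ln (1 - y)) ->
    v <= log_series M y + eps.
Proof.
move=> C0 eps0; pose x : R := 1 - expR (- C).
have x1 : x < 1 by rewrite /x ltrBlDr ltrDl expR_gt0.
have x0 : 0 <= x by rewrite /x subr_ge0 expR_le1 oppr_le0.
have [M xM] : exists M, x ^+ M / (1 - x) <= eps.
  have lim0 : (fun m => x ^+ m * (1 - x)^-1) @ \oo --> 0.
    rewrite -[X in _ --> X](mul0r (1 - x)^-1); apply: cvgM; last exact: cvg_cst.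
    by apply: cvg_expr; rewrite ger0_norm.
  have [M _ hM] := cvgr_le _ lim0 _ eps0.
  by exists M; exact: (hM M (leqnn M)).
exists M => y v /andP[y0 y1] vC vy.
have [yx|xy] := leP y x.
  apply: (le_trans (vy (le_lt_trans yx x1))).
  by apply: (le_trans (log_series_lower M _ x1)); rewrite ?y0 ?yx// lerD2l.
apply: (le_trans vC).
have -> : C = - ln (1 - x) by rewrite /x subKr expRK opprK.
apply: (le_trans (log_series_lower M _ x1)); first by rewrite x0 lexx.
by rewrite lerD// ler_log_series// ltW.
Qed.

End LogSeries.

(** * Jensen's inequality at an interior point of the disk *)

Section CircleJensen.
Context {R : realType} (w c r : R) (w0 : 0 < w) (r01 : 0 < r < 1).
Notation e := (circle_param w c).
Implicit Types F g : {poly R[i]}.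

Lemma trigpoly_log_series M u : trigpoly w c u ->
  trigpoly w c (fun t => log_series M (u t)).
Proof.
move=> tu; elim: M => [|M IH].
  under eq_fun do rewrite /log_series big_ord0; exact: trigpoly_cst.
under eq_fun do rewrite log_series_S.
apply: trigpolyD => //; apply: trigpolyM; last exact: trigpoly_cst.
exact: trigpolyX.
Qed.

Lemma trigpoly_circle_defect F K :
  trigpoly w c (fun t => 1 - cmod F.[e t] ^+ 2 / K ^+ 2).
Proof.
under eq_fun do rewrite -mulrN.
apply: trigpolyD; first exact: trigpoly_cst.
by apply: trigpolyM; [exact: trigpoly_sqr_cmod|exact: trigpoly_cst].
Qed.

Lemma poisson_ge0 u : (forall t, 0 <= u t) -> 0 <= poisson w c r u.
Proof.
move=> u0; rewrite /poisson mulr_ge0 ?divr_ge0 ?mulr_ge0 ?pi_ge0 ?(ltW w0)//.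
by apply: Rintegral_ge0 => t _; rewrite mulr_ge0// poisson_kernel_ge0.
Qed.

Lemma ler_ln1D (x : R) : 0 <= x -> x / (1 + x) <= ln (1 + x).
Proof.
move=> x0; have x1 : 0 < 1 + x by rewrite ltr_pwDl.
rewrite -[leRHS]opprK -lnV ?posrE// lerNr.
have E : (1 + x)^-1 = 1 - x / (1 + x) by field; rewrite lt0r_neq0.
rewrite [X in ln X]E; apply: le_ln1Dx; rewrite ltrN2 ltr_pdivrMr// mul1r; lra.
Qed.

Lemma sqr_cmod1D (z : R[i]) (q : R) :
  cmod (1 + q%:C * z) ^+ 2 = 1 + 2 * q * complex.Re z + q ^+ 2 * cmod z ^+ 2.
Proof. by rewrite !sqr_cmod; case: z => a b /=; ring. Qed.

(** Up to the replacement of the logarithm by its partial sum, this is Jensen's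
    inequality [ln |F r| <= Poisson integral of ln |F|], and it allows [F] to
    vanish on the circle. The maximum principle for [F * expR (g / 2)], where
    [Re g] is the trigonometric polynomial on the left, would give it at once;
    the polynomials [F * (1 + g / (2 n)) ^+ n] replace that function, at the
    price of a limit in [n]. *)
Lemma poisson_log_series_le F (K : R) M : 0 < K ->
  (forall t, cmod F.[e t] <= K) -> F.[r%:C] != 0 ->
  poisson w c r (fun t => log_series M (1 - cmod F.[e t] ^+ 2 / K ^+ 2)) <=
    2 * ln (K / cmod F.[r%:C]).
Proof.
move=> K0 FK Fr.
pose U t := log_series M (1 - cmod F.[e t] ^+ 2 / K ^+ 2).
have FK01 t : 0 <= cmod F.[e t] ^+ 2 / K ^+ 2 <= 1.
  rewrite divr_ge0 ?sqr_ge0//= ler_pdivrMr ?exprn_gt0// mul1r.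
  by rewrite lerXn2r ?nnegrE ?cmod_ge0// ltW.
have U0 t : 0 <= U t.
  by apply: log_series_ge0; rewrite subr_ge0; case/andP: (FK01 t).
have FU t : cmod F.[e t] ^+ 2 * expR (U t) <= K ^+ 2.
  have /andP[h0 h1] := FK01 t.
  have : 0 <= 1 - cmod F.[e t] ^+ 2 / K ^+ 2 <= 1.
    by rewrite subr_ge0 h1 lerBlDr lerDl h0.
  move=> /(log_series_upper M); rewrite subKr -/(U t).
  by rewrite mulrAC ler_pdivrMr ?exprn_gt0// mul1r.
have [g Ug] : trigpoly w c U.
  by apply: trigpoly_log_series; exact: trigpoly_circle_defect.
have [D gD] := circle_horner_bounded w c g.
have Ev : poisson w c r U = complex.Re g.[r%:C].
  by rewrite -(poisson_poly c w0 r01); congr poisson; exact/funext.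
have v0 : 0 <= complex.Re g.[r%:C] by rewrite -Ev; exact: poisson_ge0.
rewrite -/U Ev; move: v0; set v := complex.Re _ => v0.
have Fr0 : 0 < cmod F.[r%:C] by rewrite lt_neqAle eq_sym cmod_eq0 Fr cmod_ge0.
set L := 2 * ln _.
(* With [n = N + 1] and [harmonic N = 1 / n]: on the circle [|1 + g / (2 n)| ^
   (2 n) <= expR (U + D ^ 2 / (4 n))], and at [r] the left-hand side is at least
   [(1 + v / (2 n)) ^ (2 n)]. *)
have step (N : nat) : v <= (1 + v / 2 * harmonic N) * (L + D ^+ 2 / 4 * harmonic N).
  pose n := N.+1; pose q : R := 2^-1 * harmonic N.
  have hN : 0 < harmonic N :> R by rewrite /harmonic/= invr_gt0.
  have hn : n%:R * harmonic N = 1 :> R by rewrite /harmonic/= mulfV ?pnatr_eq0.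
  have q0 : 0 < q by rewrite mulr_gt0.
  pose H := F * (1 + q%:C%:P * g) ^+ n.
  have HE z : cmod H.[z] ^+ 2 = cmod F.[z] ^+ 2 * (cmod (1 + q%:C * g.[z]) ^+ 2) ^+ n.
    rewrite /H hornerM horner_exp hornerD hornerCM hornerC cmodM cmodX exprMn.
    by rewrite -!exprM mulnC.
  have HB t : cmod H.[e t] ^+ 2 <= K ^+ 2 * expR (D ^+ 2 / 4 * harmonic N).
    rewrite HE.
    have : (cmod (1 + q%:C * g.[e t]) ^+ 2) ^+ n <=
        expR (U t) * expR (D ^+ 2 / 4 * harmonic N).
      rewrite -expRD.
      have -> : U t + D ^+ 2 / 4 * harmonic N =
          n%:R * (2 * q * U t + q ^+ 2 * D ^+ 2).
        rewrite /q; transitivity ((n%:R * harmonic N) * (U t + harmonic N * D ^+ 2 / 4)).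
          by rewrite hn; ring.
        by field.
      rewrite expRM_natl lerXn2r ?nnegrE ?sqr_ge0 ?expR_ge0//.
      rewrite sqr_cmod1D -Ug (le_trans _ (expR_ge1Dx _))// addrA lerD2l.
      rewrite ler_wpM2l ?sqr_ge0// lerXn2r ?nnegrE ?cmod_ge0//.
      by rewrite (le_trans (cmod_ge0 g.[e t])).
    move=> h; apply: (le_trans (ler_wpM2l (sqr_ge0 _) h)).
    by rewrite mulrA ler_wpM2r ?expR_ge0.
  pose B := Num.sqrt (K ^+ 2 * expR (D ^+ 2 / 4 * harmonic N)).
  have B2 : B ^+ 2 = K ^+ 2 * expR (D ^+ 2 / 4 * harmonic N).
    by rewrite sqr_sqrtr// mulr_ge0 ?sqr_ge0 ?expR_ge0.
  have : cmod H.[r%:C] <= B.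
    apply: (disk_maximum_modulus w0 r01) => t.
    by rewrite -(@ler_pXn2r _ 2) ?nnegrE ?cmod_ge0 ?sqrtr_ge0// B2.
  rewrite -(@ler_pXn2r _ 2) ?nnegrE ?cmod_ge0 ?sqrtr_ge0// B2 HE => Hr.
  have qv : 0 < 1 + q * v by rewrite ltr_pwDl// mulr_ge0// ltW.
  have : cmod F.[r%:C] ^+ 2 * ((1 + q * v) ^+ 2) ^+ n <=
      K ^+ 2 * expR (D ^+ 2 / 4 * harmonic N).
    apply: le_trans Hr; rewrite ler_wpM2l ?sqr_ge0// lerXn2r ?nnegrE ?sqr_ge0//.
    rewrite sqr_cmod1D -/v.
    have : q ^+ 2 * v ^+ 2 <= q ^+ 2 * cmod g.[r%:C] ^+ 2.
      rewrite ler_wpM2l ?sqr_ge0// lerXn2r ?nnegrE ?cmod_ge0//.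
      by rewrite (le_trans (ler_norm _))// Re_le_cmod.
    by rewrite sqrrD mul1r expr1n [(q * v) ^+ 2]exprMn; clearbody q; lra.
  rewrite -ler_ln ?posrE ?mulr_gt0 ?exprn_gt0 ?expR_gt0//.
  rewrite !lnM ?posrE ?exprn_gt0 ?expR_gt0// expRK !lnXn ?exprn_gt0//.
  (* [ln (1 + x) >= x / (1 + x)] keeps the estimate rational in [harmonic N]. *)
  have lnq := ler_ln1D (mulr_ge0 (ltW q0) v0).
  rewrite -(mulr_natr (_ *+ 2) n) -!(mulr_natr (ln _) 2) => h1.
  have Lh : 2 * n%:R * ln (1 + q * v) <= L + D ^+ 2 / 4 * harmonic N.
    rewrite /L lnM ?posrE ?invr_gt0// lnV ?posrE//; lra.
  have : 2 * n%:R * (q * v / (1 + q * v)) <= L + D ^+ 2 / 4 * harmonic N.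
    by apply: le_trans Lh; rewrite ler_wpM2l// mulr_ge0.
  have -> : 2 * n%:R * (q * v / (1 + q * v)) = v / (1 + q * v).
    rewrite mulrA; congr (_ / _).
    transitivity ((n%:R * harmonic N) * v); last by rewrite hn mul1r.
    by rewrite /q; field.
  rewrite ler_pdivrMr// mulrC.
  by rewrite [X in _ <= (1 + X) * _ -> _](_ : _ = v / 2 * harmonic N)//; rewrite /q; ring.
have lim : (fun N => (1 + v / 2 * harmonic N) * (L + D ^+ 2 / 4 * harmonic N)) @ \oo --> L.
  have cvgh (k l : R) : (fun N => k + l * harmonic N) @ \oo --> k + l * 0.
    apply: cvgD; first exact: cvg_cst.
    by apply: cvgM; [exact: cvg_cst|exact: cvg_harmonic].
  have := cvgM (cvgh 1 (v / 2)) (cvgh L (D ^+ 2 / 4)).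
  by rewrite !mulr0 !addr0 mul1r; apply.
by apply: (cvgr_to_ge lim); exact: nearW.
Qed.

End CircleJensen.

(** * Polynomials: from the Poisson integral to a power mean *)

Section KernelBound.
Context {R : realType}.
Implicit Types x y : R.

Let sqr_normr x : `|x| ^+ 2 = x ^+ 2.
Proof. by rewrite real_normK ?num_real. Qed.

Lemma norm_sinB x y : `|sin x - sin y| <= `|x - y|.
Proof.
wlog yx : x y / y <= x.
  by move=> H; have [/H//|/ltW/H] := leP y x; rewrite distrC (distrC y).
have [|z _ ->] := @MVT_segment R sin cos y x yx (fun z _ => is_derive_sin z).
  by apply: continuous_subspaceT => z; exact: continuous_sin.
by rewrite normrM ler_piMl// cos_max.
Qed.

Lemma norm_cosB x y : `|cos x - cos y| <= `|x - y|.
Proof.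
wlog yx : x y / y <= x.
  by move=> H; have [/H//|/ltW/H] := leP y x; rewrite distrC (distrC y).
have [|z _ ->] := @MVT_segment R cos (fun z => - sin z) y x yx (fun z _ => is_derive_cos z).
  by apply: continuous_subspaceT => z; exact: continuous_cos.
by rewrite normrM ler_piMl// normrN sin_max.
Qed.

Lemma one_sub_cos_le x : 1 - cos x <= x ^+ 2 / 2.
Proof.
have -> : x = (x / 2) *+ 2 by rewrite -mulr_natr divfK.
rewrite cos_mulr2n cos2sin2; set y := x / 2.
have : sin y ^+ 2 <= y ^+ 2.
  rewrite -[leLHS]sqr_normr -[leRHS]sqr_normr lerXn2r ?nnegrE//.
  by have := norm_sinB y 0; rewrite sin0 !subr0.
lra.
Qed.

(** Equivalent to [tanh (x / 2) <= x / 2]; it compares the peak of the Poisson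
    kernel of the disk with that of the half-plane. *)
Lemma tanh_half_bound x : 0 <= x -> 2 * (1 - expR (- x)) <= x * (1 + expR (- x)).
Proof.
move=> x0.
pose f z : R := z * (1 + expR (- z)) - 2 * (1 - expR (- z)).
pose df z : R := 1 - (1 + z) * expR (- z).
have der z : is_derive z (1 : R) f (df z).
  apply: is_derive_eq; rewrite /df /GRing.scale/=; ring.
have cf z : {for z, continuous f}.
  by apply/differentiable_continuous/derivable1_diffP; case: (der z).
have [|z] := @MVT_segment R f df 0 x x0 (fun z _ => der z).
  exact: continuous_subspaceT.
rewrite in_itv/= => /andP[z0 zx] E.
have : 0 <= f x - f 0.
  rewrite E subr0 mulr_ge0// subr_ge0 expRN ler_pdivrMr ?expR_gt0// mul1r.
  exact: expR_ge1Dx.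
by rewrite /f oppr0 expR0 subrr mul0r mulr0 subr0 subr_ge0; lra.
Qed.

(** The right-hand side is the kernel of the disk at radius [expR (- (h * w))]
    in the scale of the variable [t]. It is the periodization of the kernel [h /
    (pi * (h ^+ 2 + (t - c) ^+ 2))] of the half-plane, hence larger; the
    half-length [delta / 2] is relaxed to [delta]. *)
Lemma poisson_kernel_lower_bound (w c h delta t : R) : 0 < w -> 0 < h ->
  `|t - c| <= delta / 2 ->
  h / (pi * (h ^+ 2 + delta ^+ 2)) <=
    w / (2 * pi) * poisson_kernel w c (expR (- (h * w))) t.
Proof.
move=> w0 h0 td.
set r := expR _; set x := h * w; pose y := w * delta.
have x0 : 0 < x by rewrite mulr_gt0.
have r0 : 0 < r by rewrite expR_gt0.
have r1 : r < 1 by rewrite expR_lt1 oppr_lt0.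
have xr : x * r <= 1 - r.
  have := expR_ge1Dx x; rewrite -(ler_pM2r r0) /r -/x expRxMexpNx_1; lra.
have xr2 : 2 * (1 - r) <= x * (1 + r) by exact: tanh_half_bound (ltW x0).
have y2 : (w * (t - c)) ^+ 2 <= y ^+ 2 / 4.
  have td2 : (t - c) ^+ 2 <= delta ^+ 2 / 4.
    have -> : delta ^+ 2 / 4 = (delta / 2) ^+ 2 by field.
    by rewrite -[leLHS]sqr_normr lerXn2r ?nnegrE// (le_trans _ td).
  by rewrite /y !exprMn -[leRHS]mulrA ler_wpM2l ?sqr_ge0.
have den0 : 0 < 1 - 2 * r * cos (w * (t - c)) + r ^+ 2.
  by apply: poisson_kernel_den_gt0; rewrite r0.
have key : 2 * x / (x ^+ 2 + y ^+ 2) <= poisson_kernel w c r t.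
  rewrite /poisson_kernel ler_pdivrMr; last by rewrite ltr_pwDl ?exprn_gt0 ?sqr_ge0.
  rewrite mulrAC ler_pdivlMr//.
  apply: (@le_trans _ _ (2 * x * ((1 - r) ^+ 2 + r * y ^+ 2 / 2))).
    have xx : 0 < 2 * x by rewrite mulr_gt0.
    rewrite (ler_pM2l xx).
    have : 1 - cos (w * (t - c)) <= y ^+ 2 / 4.
      apply: (le_trans (one_sub_cos_le _)); have := sqr_ge0 y; lra.
    by rewrite -(ler_pM2l r0); nra.
  (* The difference of the two sides is the sum of the next two quantities, the
     first free of [y] and the second proportional to [y ^+ 2]. *)
  have h1 : 0 <= x * (1 - r) * (x * (1 + r) - 2 * (1 - r)).
    by rewrite mulr_ge0 ?subr_ge0// mulr_ge0 ?subr_ge0 ?ltW.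
  have h2 : 0 <= y ^+ 2 * ((1 - r) * (1 + r) - x * r).
    have rr : 0 < (1 - r) * r by rewrite mulr_gt0 ?subr_gt0.
    by rewrite mulr_ge0 ?sqr_ge0//; lra.
  by clearbody x y r; lra.
have -> : h / (pi * (h ^+ 2 + delta ^+ 2)) = w / (2 * pi) * (2 * x / (x ^+ 2 + y ^+ 2)).
  have hd : 0 < h ^+ 2 + delta ^+ 2 by rewrite ltr_pwDl ?exprn_gt0 ?sqr_ge0.
  rewrite /x /y; move: (pi : R) (pi_gt0 R) => q q0.
  have hw : 0 < (h * w) ^+ 2 + (w * delta) ^+ 2.
    by rewrite ltr_pwDl ?exprn_gt0 ?sqr_ge0 ?mulr_gt0.
  by field; rewrite !lt0r_neq0.
by rewrite ler_pM2l// divr_gt0// mulr_gt0// pi_gt0.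
Qed.

End KernelBound.

Section PolynomialBound.
Context {R : realType}.
Notation mu := (@lebesgue_measure R).

Lemma integrable_itvD (a b : R) (f g : R -> R) :
  mu.-integrable `[a, b] (EFin \o f) -> mu.-integrable `[a, b] (EFin \o g) ->
  mu.-integrable `[a, b] (EFin \o (fun t => f t + g t)).
Proof.
move=> fi gi; apply: (@eq_integrable _ _ _ mu `[a, b] _ ((EFin \o f) \+ (EFin \o g))%E) => //.
exact: integrableD.
Qed.

Lemma integrable_itvZ (a b k : R) (f : R -> R) :
  mu.-integrable `[a, b] (EFin \o f) ->
  mu.-integrable `[a, b] (EFin \o (fun t => k * f t)).
Proof.
move=> fi; apply: (@eq_integrable _ _ _ mu `[a, b] _ (fun t => k%:E * (EFin \o f) t)%E) => //.
exact: integrableZl.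
Qed.

Lemma measurable_powR_cmod_poly (w c p : R) (F : {poly R[i]}) (D : set R) :
  measurable_fun D (fun t => cmod F.[circle_param w c t] `^ p).
Proof.
apply: measurable_funTS.
apply: (measurableT_comp (f := fun x => x `^ p)); first exact: measurable_realfun.measurable_powR.
have -> : (fun t => cmod F.[circle_param w c t]) =
    Num.sqrt \o (fun t => cmod F.[circle_param w c t] ^+ 2).
  by apply/funext => t /=; rewrite sqrtr_sqr ger0_norm ?cmod_ge0.
apply: measurableT_comp.
  by apply: measurable_realfun.continuous_measurable_fun; exact: sqrt_continuous.
apply: measurable_realfun.continuous_measurable_fun.
exact: trigpoly_continuous (trigpoly_sqr_cmod _ _ _).
Qed.

Lemma integrable_powR_cmod_poly (w c p K a b : R) (F : {poly R[i]}) : 0 < p ->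
  (forall t, cmod F.[circle_param w c t] <= K) ->
  mu.-integrable `[a, b] (EFin \o (fun t => cmod F.[circle_param w c t] `^ p)).
Proof.
move=> p0 FK; apply: measurable_bounded_integrable => //.
- by rewrite /= lebesgue_measure_itv/=; case: ifPn => // _; rewrite -EFinD ltry.
- exact: measurable_powR_cmod_poly.
exists (K `^ p); split => // y Ky t _ /=.
rewrite ger0_norm ?powR_ge0// (le_trans _ (ltW Ky))// ge0_ler_powR ?nnegrE ?cmod_ge0 ?(ltW p0)//.
by rewrite (le_trans (cmod_ge0 F.[circle_param w c t])).
Qed.

Lemma interval_le_poisson (w h T delta : R) (U : R -> R) : 0 < w -> 0 < h ->
  0 < delta -> w * delta <= 2 * pi -> continuous U -> (forall t, 0 <= U t) ->
  h / (pi * (h ^+ 2 + delta ^+ 2)) * \int[mu]_(t in `[T, T + delta]) U t <=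
    poisson w (T + delta / 2) (expR (- (h * w))) U.
Proof.
move=> w0 h0 d0 wd cU U0; set c := T + delta / 2; set r := expR _.
have r01 : 0 < r < 1 by rewrite expR_gt0 expR_lt1 oppr_lt0 mulr_gt0.
have cP : continuous (fun t => poisson_kernel w c r t * U t).
  by move=> t; apply: cvgM; [exact: continuous_poisson_kernel|exact: cU].
have cZ (k : R) (f : R -> R) : continuous f -> continuous (fun t => k * f t).
  by move=> cf t; apply: cvgM; [exact: cvg_cst|exact: cf].
have wp : 0 <= w / (2 * pi) by rewrite divr_ge0 ?mulr_ge0 ?pi_ge0 ?(ltW w0).
have dw : delta / 2 <= pi / w by rewrite ler_pdivlMr// mulrAC ler_pdivrMr// mulrC (mulrC pi).
apply: (@le_trans _ _ (w / (2 * pi) * \int[mu]_(t in `[T, T + delta]) (poisson_kernel w c r t * U t))).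
  rewrite -!RintegralZl//; try exact: continuous_itv_integrable.
  apply: le_Rintegral => //.
  - by apply: continuous_itv_integrable; exact: cZ.
  - by apply: continuous_itv_integrable; exact: cZ.
  move=> t; rewrite /= in_itv/= => /andP[t1 t2].
  rewrite mulrA ler_wpM2r// poisson_kernel_lower_bound//.
  by rewrite ler_norml /c; apply/andP; split; lra.
rewrite /poisson ler_wpM2l//; apply: le_Rintegral_subset => //.
- by move=> t; rewrite mulr_ge0// poisson_kernel_ge0.
- by rewrite /c; lra.
- by rewrite /c; lra.
Qed.

(** The tangent line to [exp]: this is Jensen's inequality for the exponential
    before integration. *)
Lemma powR_log_tangent (p B x : R) : 0 < p -> 0 < x ->
  2 / p * (1 + p * B - expR (p * B) * x `^ p) <= - ln (x ^+ 2).
Proof.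
move=> p0 x0; rewrite lnXn// -mulr_natr.
have h : 1 + (p * B + p * ln x) <= expR (p * B) * x `^ p.
  by rewrite /powR gt_eqF// -expRD; exact: expR_ge1Dx.
rewrite mulrAC ler_pdivrMr//; nra.
Qed.

(** The mean over the interval of [ln (K ^+ 2 / |F| ^+ 2)] is bounded by twice
    the exponent through the Poisson integral, then integrating the tangent
    inequality at the expected value of the mean bounds the mean itself from
    below. The bound does not involve [w]. *)
Lemma polynomial_mean_lower_bound (w T lam K p delta : R) (F : {poly R[i]}) :
  0 < w -> 0 < lam -> 1 <= K -> 0 < p -> 0 < delta -> w * delta <= 2 * pi ->
  let A := ln K + ln 2 in
  let c := T + delta / 2 in
  (forall t, cmod F.[circle_param w c t] <= K) ->
  2^-1 <= cmod F.[(expR (- (A / lam * w)))%:C] ->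
  expR (- (p * (pi * (A ^+ 2 / (lam * delta) + lam * delta)))) <=
    1 / delta * \int[mu]_(t in `[T, T + delta]) (cmod F.[circle_param w c t] `^ p).
Proof.
move=> w0 l0 K1 p0 d0 wd A c FK Fr; set B := pi * _.
have K0 : 0 < K by rewrite (lt_le_trans _ K1).
have A0 : 0 < A by rewrite ltr_wpDl ?ln_ge0// ln_gt0// ltr1n.
pose h := A / lam; have h0 : 0 < h by rewrite divr_gt0.
have B0 : 0 <= B by rewrite mulr_ge0 ?pi_ge0// addr_ge0 ?divr_ge0 ?sqr_ge0 ?mulr_ge0 ?ltW.
set r := expR _ in Fr.
have r01 : 0 < r < 1 by rewrite expR_gt0 expR_lt1 oppr_lt0 mulr_gt0.
pose x2 t := cmod F.[circle_param w c t] ^+ 2 / K ^+ 2.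
have x201 t : 0 <= x2 t <= 1.
  rewrite /x2 divr_ge0 ?sqr_ge0//= ler_pdivrMr ?exprn_gt0// mul1r.
  by rewrite lerXn2r ?nnegrE ?cmod_ge0// ltW.
pose U M t := log_series M (1 - x2 t).
have cU M : continuous (U M).
  by apply: trigpoly_continuous; apply: trigpoly_log_series; exact: trigpoly_circle_defect.
have U0 M t : 0 <= U M t.
  by apply: log_series_ge0; rewrite subr_ge0; case/andP: (x201 t).
have Fr0 : 0 < cmod F.[r%:C] by rewrite (lt_le_trans _ Fr).
have UB M : \int[mu]_(t in `[T, T + delta]) U M t <= 2 * B * delta.
  have h1 := interval_le_poisson T w0 h0 d0 wd (cU M) (U0 M).
  have h2 : poisson w c r (U M) <= 2 * A.
    apply: (le_trans (poisson_log_series_le w0 r01 M K0 FK _)).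
      by rewrite -cmod_eq0 gt_eqF.
    rewrite ler_pM2l// /A -lnM ?posrE// ler_ln ?posrE ?divr_gt0 ?mulr_gt0//.
    by rewrite ler_pdivrMr// -mulrA ler_peMr ?(ltW K0)//; lra.
  have hd : 0 < h ^+ 2 + delta ^+ 2 by rewrite ltr_pwDl ?exprn_gt0 ?sqr_ge0.
  have pp : 0 < pi :> R := pi_gt0 R.
  have := le_trans h1 h2; rewrite mulrC -ler_pdivlMr; last by rewrite divr_gt0// mulr_gt0.
  move=> /le_trans; apply; rewrite le_eqVlt; apply/orP; left; apply/eqP.
  rewrite /B /h; move: hd; rewrite /h; move: (pi : R) pp => q q0 hd.
  have Al : 0 < A ^+ 2 + (delta * lam) ^+ 2.
    by rewrite ltr_pwDl ?exprn_gt0 ?sqr_ge0.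
  by field; rewrite !lt0r_neq0.
pose g t := cmod F.[circle_param w c t] `^ p.
have ig : mu.-integrable `[T, T + delta] (EFin \o g) by exact: integrable_powR_cmod_poly.
have pB : 0 <= p * B by rewrite mulr_ge0 ?(ltW p0).
have tail (eps : R) : 0 < eps ->
    2 / p * (1 + p * B) * delta <=
    (2 * B + eps) * delta + 2 / p * expR (p * B) * \int[mu]_(t in `[T, T + delta]) g t.
  move=> e0.
  have C0 : 0 <= 2 / p * (1 + p * B) by rewrite mulr_ge0 ?divr_ge0 ?addr_ge0 ?(ltW p0).
  have [M hM] := log_series_dini C0 e0.
  have icst (k : R) : \int[mu]_(t in `[T, T + delta]) k = k * delta.
    by rewrite Rintegral_cst_itv ?lerDl ?ltW// addrC addKr.
  have ccst (k : R) : mu.-integrable `[T, T + delta] (EFin \o (fun=> k)).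
    by apply: continuous_itv_integrable => t; exact: cvg_cst.
  have iU : mu.-integrable `[T, T + delta] (EFin \o U M) by exact: continuous_itv_integrable.
  have iUe : mu.-integrable `[T, T + delta] (EFin \o (fun t => U M t + eps)).
    exact: integrable_itvD iU (ccst eps).
  have igk := integrable_itvZ (2 / p * expR (p * B)) ig.
  rewrite (mulrDl (2 * B)); apply: (@le_trans _ _ (\int[mu]_(t in `[T, T + delta])
      ((U M t + eps) + 2 / p * expR (p * B) * g t))).
    rewrite -icst; apply: le_Rintegral => //; first exact: integrable_itvD iUe igk.
    move=> t _; rewrite -lerBlDr.
    have /andP[x0 x1] := x201 t.
    apply: hM => [|| y1].
    - by rewrite subr_ge0 x1 lerBlDr lerDl.
    - by rewrite lerBlDr lerDl !mulr_ge0 ?invr_ge0 ?expR_ge0 ?powR_ge0 ?(ltW p0).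
    rewrite subKr.
    (* [y < 1] means that [F] does not vanish here. *)
    have Ft : 0 < cmod F.[circle_param w c t].
      rewrite lt_neqAle cmod_ge0 andbT eq_sym; apply/eqP => F0.
      by move: y1; rewrite /x2 F0 expr0n mul0r subr0 ltxx.
    rewrite -(mulrA (2 / p)) -mulrBr (le_trans (powR_log_tangent B p0 Ft))//.
    rewrite lerN2 ler_ln ?posrE ?divr_gt0 ?exprn_gt0//.
    by rewrite ler_pdivrMr ?exprn_gt0// ler_peMr ?sqr_ge0// exprn_ege1.
  rewrite (RintegralD _ iUe igk)// (RintegralD _ iU (ccst eps))// icst.
  by rewrite (RintegralZl _ _ ig)// lerD2r lerD2r.
(* Letting [eps] vanish in [tail] leaves [1 <= expR (p * B) * mean]. *)
rewrite expRN -[leLHS]mul1r ler_pdivrMr ?expR_gt0//.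
rewrite -(ler_pM2r d0); apply/ler_addgt0Pr => eta eta0.
have := tail (2 / p * (eta / delta)) _.
rewrite mulr_gt0 ?divr_gt0// => /(_ isT) h1.
have p2 : 0 < 2 / p by rewrite divr_gt0.
rewrite -(ler_pM2l p2).
rewrite -/g; move: h1; set J := \int[mu]_(t in _) g t => h1.
have E1 : 2 / p * (1 * delta) = 2 / p * (1 + p * B) * delta - 2 * B * delta.
  by field; rewrite lt0r_neq0.
have E2 : 2 / p * (1 / delta * J * expR (p * B) * delta + eta) =
   2 / p * (eta / delta) * delta + 2 / p * expR (p * B) * J.
  by field; rewrite !lt0r_neq0.
by rewrite E1 E2; lra.
Qed.

End PolynomialBound.

(** * Complex series and limits *)

Section Limits.
Context {R : realType}.

(** Convergence in [R[i]] for the norm is convergence of both parts. *)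
Lemma cvg_complex (v : nat -> R[i]) (x y : R) :
  (fun n => complex.Re (v n)) @ \oo --> x ->
  (fun n => complex.Im (v n)) @ \oo --> y ->
  (v : nat -> (R[i] : numFieldType)) @ \oo --> (x +i* y : (R[i] : numFieldType)).
Proof.
move=> vx vy; apply/cvgrPdist_lt => e e0.
have [E E0 ->] : exists2 E : R, 0 < E & e = E%:C.
  move: e0; rewrite ltcE => /andP[/eqP ei er]; exists (complex.Re e) => //.
  by case: e ei {er} => a b /= ->.
have E2 : 0 < E / 2 by rewrite divr_gt0.
move/cvgrPdist_lt : vx => /(_ _ E2); move/cvgrPdist_lt : vy => /(_ _ E2).
apply: filterS2 => n hy hx; rewrite -cmodE ltcR.
apply: (le_lt_trans (cmod_le_ReIm _)).
by case: (v n) hx hy => a b /= hx hy; rewrite (splitr E) ltrD.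
Qed.

Lemma abs_cvg_complex (u : nat -> R[i]) (alpha : R^nat) :
  (forall n, cmod (u n) <= alpha n) -> cvgn (series alpha) ->
  exists l, (series u : nat -> (R[i] : numFieldType)) @ \oo --> (l : (R[i] : numFieldType)) /\
    (fun N => cmod (l - \sum_(k < N) u k)) @ \oo --> (0 : R).
Proof.
move=> ua ca.
have cpart (f : {additive R[i] -> R}) : (forall z, `|f z| <= cmod z) ->
    exists x : R, (fun n => f (\sum_(k < n) u k)) @ \oo --> x.
  move=> fz; have := @normed_cvg R R (fun n => f (u n)).
  have a0 n : 0 <= alpha n by rewrite (le_trans _ (ua n)) ?cmod_ge0.
  move=> /(_ (@series_le_cvg R (fun n => `|f (u n)|) alpha _ a0 _ ca)) h.
  have /cvg_ex[x hx] : cvgn (series (fun n => f (u n))).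
    by apply: h => n //; rewrite (le_trans (fz _)).
  have fE : (fun n => f (\sum_(k < n) u k)) = series (fun n => f (u n)).
    by apply/funext => n; rewrite raddf_sum /series/= big_mkord.
  by exists x; rewrite fE.
have [x hx] := cpart (@complex.Re R : {additive Rcomplex R -> R}) (@Re_le_cmod R).
have [y hy] := cpart (@complex.Im R : {additive Rcomplex R -> R}) (@Im_le_cmod R).
exists (x +i* y); split.
  have sE : series u = (fun n => \sum_(k < n) u k).
    by apply/funext => n; rewrite /series/= big_mkord.
  by rewrite sE; apply: cvg_complex.
have hxy : (fun N => `|x - complex.Re (\sum_(k < N) u k)| +
    `|y - complex.Im (\sum_(k < N) u k)|) @ \oo --> (0 : R).
  rewrite -[X in _ --> X](addr0 0); apply: cvgD; rewrite -[X in _ --> X](normr0 R);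
    apply: cvg_norm; [rewrite -[X in _ --> X](subrr x)|rewrite -[X in _ --> X](subrr y)];
    by apply: cvgB => //; exact: cvg_cst.
apply: (squeeze_cvgr _ (cvg_cst 0) hxy).
apply: nearW => N; rewrite cmod_ge0/= (le_trans (cmod_le_ReIm _))//.
by case: (\sum_(k < N) u k).
Qed.

(** Continuity of the power at [x > 0] comes from its derivative, which need not
    exist at [0]. *)
Lemma cvg_powR (p : R) (v : R^nat) (x : R) : 0 < p -> (forall n, 0 <= v n) ->
  v @ \oo --> x -> (fun n => v n `^ p) @ \oo --> x `^ p.
Proof.
move=> p0 v0 vx.
have x0 : 0 <= x by apply: (cvgr_to_ge vx); exact: nearW.
move: x0; rewrite le_eqVlt => /predU1P[x0|x0]; last first.
  have cp : {for x, continuous (fun a : R => a `^ p)}.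
    apply/differentiable_continuous/derivable1_diffP.
    by apply: derivable_powR; rewrite in_itv/= x0.
  exact: (@continuous_cvg nat R R \oo _ v (fun a : R => a `^ p) x cp vx).
rewrite -x0 powR0 ?gt_eqF//; apply/cvgr0Pnorm_lt => e e0.
have e1 : 0 < e `^ p^-1 by rewrite powR_gt0.
move/cvgrPdist_lt : vx => /(_ _ e1); apply: filterS => n.
rewrite -x0 sub0r normrN ger0_norm// ger0_norm ?powR_ge0// => h.
have -> : e = (e `^ p^-1) `^ p by rewrite -powRrM mulVf ?gt_eqF// powRr1// ltW.
by apply: gt0_ltr_powR; rewrite ?nnegrE// ltW.
Qed.

End Limits.

(** * Approximating a Dirichlet series by polynomials *)

Definition mesh (R : realType) (N : nat) : R := N.+1%:R^-1.

Lemma cvg_mul_mesh (R : realType) (k : R) : (fun N => k * mesh R N) @ \oo --> (0 : R).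
Proof.
have : (fun N => k * harmonic N) @ \oo --> k * 0.
  by apply: cvgM; [exact: cvg_cst|exact: cvg_harmonic].
by rewrite mulr0.
Qed.

Section DirichletApproximation.
Context {R : realType} (sigma c : R) (a : nat -> R[i]) (lambda : R^nat).
Context (hlambda : dirichlet_exponents lambda).
Context (hcvg : dirichlet_abs_cvg a lambda sigma).
Context (ha0 : a 0%N = 1).

Local Notation mesh := (mesh R).
Let alpha := dirichlet_abs_terms a lambda sigma.
Let K := dirichlet_norm1 a lambda sigma.

Let alpha_ge0 n : 0 <= alpha n.
Proof. by rewrite /alpha /dirichlet_abs_terms mulr_ge0 ?cmod_ge0 ?expR_ge0. Qed.

Let alpha0 : alpha 0%N = 1.
Proof.
by rewrite /alpha /dirichlet_abs_terms ha0 cmod1 (proj1 hlambda) oppr0 mul0r expR0 mulr1.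
Qed.

Lemma dirichlet_partial_sum_le N : \sum_(k < N) alpha k <= K.
Proof.
have := @nondecreasing_cvgn_le R (series alpha) _ hcvg N.
rewrite /series/= big_mkord; apply.
by apply: nondecreasing_series.
Qed.

Lemma dirichlet_norm1_ge1 : 1 <= K.
Proof. by have := dirichlet_partial_sum_le 1; rewrite big_ord1 alpha0. Qed.

Let lambda_homo : {homo lambda : m n / (m <= n)%N >-> m <= n}.
Proof.
by apply: homo_leq => [x//|y x z|n]; [exact: le_trans|exact: ltW (proj2 hlambda n)].
Qed.

Let lambda_ge0 n : 0 <= lambda n.
Proof. by rewrite -(proj1 hlambda) lambda_homo. Qed.

(** The coefficients of the series recentred at [sigma + i c], so that the
    interval is centred at the origin of the phase. *)
Definition line_coef n := a n * cexp (- (lambda n)%:C * (sigma +i* c)).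

Lemma cmod_cexp (z : R[i]) : cmod (cexp z) = expR (complex.Re z).
Proof.
rewrite /cexp cmodM cmod_real ger0_norm ?expR_ge0// -[RHS]mulr1; congr (_ * _).
apply: (@pexpIrn _ 2); rewrite ?nnegrE ?cmod_ge0//.
by rewrite sqr_cmod/= cos2Dsin2 expr1n.
Qed.

Lemma cmod_line_coef n : cmod (line_coef n) = alpha n.
Proof.
rewrite /line_coef cmodM cmod_cexp /alpha /dirichlet_abs_terms; congr (_ * expR _).
by rewrite /=; ring.
Qed.

Lemma dirichlet_term_line n t :
  a n * cexp (- (lambda n)%:C * (sigma +i* t)) =
  line_coef n * circle_param (lambda n) c t.
Proof.
rewrite /line_coef -mulrA; congr (_ * _); rewrite /cexp -mulrA.
have E y : - (lambda n)%:C * (sigma +i* y) = (- lambda n * sigma) +i* (- lambda n * y).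
  by apply/eqP; rewrite eq_complex/=; apply/andP; split; apply/eqP; ring.
rewrite !E /=; congr (_ * _); rewrite /circle_param.
have -> : - lambda n * t = - lambda n * c - lambda n * (t - c) by ring.
rewrite cosB sinB; apply/eqP; rewrite eq_complex/=; apply/andP; split; apply/eqP; ring.
Qed.

(** Rounding down keeps [0] and the order of the exponents, so the gap between
    the first two exponents shrinks by at most one step of the mesh. *)
Definition mesh_freq N n := Num.truncn (lambda n * N.+1%:R).

Definition mesh_poly N : {poly R[i]} :=
  \sum_(n < N) (line_coef n)%:P * 'X^(mesh_freq N n).

Let mesh_gt0 N : 0 < mesh N.
Proof. by rewrite invr_gt0. Qed.

Lemma mesh_freq_bounds N n :
  lambda n - mesh N <= (mesh_freq N n)%:R * mesh N <= lambda n.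
Proof.
have N0 : 0 < N.+1%:R :> R by [].
have x0 : 0 <= lambda n * N.+1%:R by rewrite mulr_ge0.
have /andP[h1 h2] := truncn_itv x0.
rewrite /mesh ler_pdivrMr// h1 andbT -(ler_pM2r N0) mulrBl mulVf ?pnatr_eq0//.
by rewrite divfK ?pnatr_eq0// lerBlDr natr1 ltW.
Qed.

Lemma mesh_poly_horner N x :
  (mesh_poly N).[x] = \sum_(n < N) line_coef n * x ^+ mesh_freq N n.
Proof.
by rewrite horner_sum; apply: eq_bigr => n _; rewrite hornerCM hornerXn.
Qed.

Lemma cmod_mesh_poly_le N t : cmod (mesh_poly N).[circle_param (mesh N) c t] <= K.
Proof.
rewrite mesh_poly_horner (le_trans (ler_cmod_sum _ _ _))//.
rewrite (le_trans _ (dirichlet_partial_sum_le N))// ler_sum// => n _.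
by rewrite cmodM cmodX cmod_circle_param expr1n mulr1 cmod_line_coef.
Qed.

Lemma cmod_circle_paramB (u v t : R) :
  cmod (circle_param u c t - circle_param v c t) <= 2 * (`|u - v| * `|t - c|).
Proof.
rewrite (le_trans (cmod_le_ReIm _))//= -normrM mulrDl mul1r mulrBl lerD ?norm_cosB//.
by rewrite -opprD normrN norm_sinB.
Qed.

Lemma mesh_poly_approx N t :
  cmod (\sum_(n < N) line_coef n * circle_param (lambda n) c t -
        (mesh_poly N).[circle_param (mesh N) c t]) <= 2 * K * `|t - c| * mesh N.
Proof.
rewrite mesh_poly_horner -sumrB (le_trans (ler_cmod_sum _ _ _))//.
apply: (@le_trans _ _ (\sum_(n < N) alpha n * (2 * `|t - c| * mesh N))).
  apply: ler_sum => n _; rewrite -mulrBr cmodM cmod_line_coef ler_wpM2l//.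
  have -> : circle_param (mesh N) c t ^+ mesh_freq N n =
      circle_param ((mesh_freq N n)%:R * mesh N) c t.
    by rewrite circle_paramX /circle_param mulrA.
  rewrite (le_trans (cmod_circle_paramB _ _ _))// -mulrA ler_pM2l// mulrC ler_wpM2l//.
  have /andP[h1 h2] := mesh_freq_bounds N n.
  by rewrite ger0_norm ?subr_ge0// lerBlDr addrC -lerBlDr.
rewrite -mulr_suml -!mulrA (mulrCA 2 K) ler_wpM2r ?dirichlet_partial_sum_le//.
by rewrite mulr_ge0// mulr_ge0// ltW.
Qed.

(** The terms of positive index sum to at most [(K - 1) * expR (h * mesh) / (2 *
    K)], where the exponential accounts for the rounding of [lambda 1]; since [K
    - 1 < K], a fine enough mesh still leaves at most [1 / 2]. *)
Lemma mesh_poly_lower_bound (h : R) N : 0 < h ->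
  expR (- (h * lambda 1%N)) = (2 * K)^-1 -> K * h * mesh N.+1 <= 1 ->
  2^-1 <= cmod (mesh_poly N.+1).[(expR (- (h * mesh N.+1)))%:C].
Proof.
move=> h0 hl; set w := mesh _ => Khw; set r := expR _.
have K1 := dirichlet_norm1_ge1; have K0 : 0 < K by rewrite (lt_le_trans _ K1).
rewrite mesh_poly_horner big_ord_recl.
have -> : mesh_freq N.+1 (ord0 : 'I_N.+1) = 0%N.
  by rewrite /mesh_freq (proj1 hlambda) mul0r truncn0.
rewrite expr0 mulr1; set S := \sum_(i < N) _.
have l0 : cmod (line_coef 0) = 1 by rewrite cmod_line_coef.
have SB : cmod S <= (K - 1) * (expR (h * w) / (2 * K)).
  rewrite (le_trans (ler_cmod_sum _ _ _))//.
  apply: (@le_trans _ _ (\sum_(i < N) alpha i.+1 * (expR (h * w) / (2 * K)))).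
    apply: ler_sum => i _; rewrite cmodM cmod_line_coef ler_wpM2l// cmodX cmod_real.
    rewrite ger0_norm ?expR_ge0// -expRM_natl -hl -expRD ler_expR.
    have /andP[h1 _] := mesh_freq_bounds N.+1 i.+1.
    have l1 : lambda 1%N <= lambda i.+1 by exact: lambda_homo.
    have : h * (lambda 1%N - w) <= h * ((mesh_freq N.+1 i.+1)%:R * w).
      by rewrite ler_pM2l// (le_trans _ h1)// lerD2r.
    by rewrite /bump/=; lra.
  rewrite -mulr_suml ler_wpM2r ?divr_ge0 ?expR_ge0 ?mulr_ge0 ?(ltW K0)//.
  by have := dirichlet_partial_sum_le N.+1; rewrite big_ord_recl alpha0 lerBrDl.
have half : (K - 1) * (expR (h * w) / (2 * K)) <= 2^-1.
  rewrite mulrA ler_pdivrMr ?mulr_gt0// mulrA mulVf// mul1r.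
  have e1 : expR (h * w) * (1 - h * w) <= 1.
    by rewrite -[leRHS](expRxMexpNx_1 (h * w)) ler_pM2l ?expR_gt0//; exact: expR_ge1Dx.
  apply: (@le_trans _ _ (K * (expR (h * w) * (1 - h * w)))).
    by rewrite mulrCA (mulrC _ (expR _)) ler_pM2l ?expR_gt0//; lra.
  by rewrite ler_piMr// ltW.
have : cmod (line_coef 0) <= cmod (line_coef 0 + S) + cmod S.
  by rewrite -{1}(addrK S (line_coef 0)) (le_trans (ler_cmodD _ _))// cmodN.
rewrite l0; lra.
Qed.

Lemma dirichlet_line_cvg t :
  (fun N => cmod (mesh_poly N).[circle_param (mesh N) c t]) @ \oo -->
    cmod (dirichlet_series a lambda (sigma +i* t)).
Proof.
pose u n := a n * cexp (- (lambda n)%:C * (sigma +i* t)).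
have ua n : cmod (u n) <= alpha n.
  by rewrite /u dirichlet_term_line cmodM cmod_circle_param mulr1 cmod_line_coef.
have [l [lu l0]] := abs_cvg_complex ua hcvg.
have -> : dirichlet_series a lambda (sigma +i* t) = l.
  by apply: cvg_lim lu; exact: norm_hausdorff.
apply/cvgrPdist_le => e e0.
have lim0 : (fun N => cmod (l - \sum_(k < N) u k) + 2 * K * `|t - c| * mesh N) @ \oo --> (0 : R).
  by have := cvgD l0 (cvg_mul_mesh (2 * K * `|t - c|)); rewrite addr0; apply.
have [M _ hM] := cvgr_le _ lim0 _ e0.
exists M => // N MN; apply: le_trans (hM N MN).
set f := (mesh_poly N).[_].
have lf : cmod (l - f) <= cmod (l - \sum_(k < N) u k) + 2 * K * `|t - c| * mesh N.
  rewrite -(subrKA (\sum_(k < N) u k)) (le_trans (ler_cmodD _ _))// lerD2l.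
  rewrite (le_trans _ (mesh_poly_approx N t))// le_eqVlt; apply/orP; left; apply/eqP.
  by congr (cmod (_ - _)); apply: eq_bigr => n _; rewrite /u dirichlet_term_line.
have h1 : cmod l <= cmod f + cmod (l - f).
  by rewrite -{1}(subrKC f l) ler_cmodD.
have h2 : cmod f <= cmod l + cmod (l - f).
  by rewrite -(cmodN (l - f)) -{1}(subKr l f) ler_cmodD.
by apply: le_trans lf; rewrite ler_norml; apply/andP; split; lra.
Qed.

End DirichletApproximation.

(** The bound for polynomials holds as soon as the mesh is fine, and passes to
    the limit because the polynomials are bounded by the norm on the whole line.
    *)
Lemma dirichlet_mean_lower_bound (R : realType) (sigma T : R) (a : nat -> R[i])
    (lambda : R^nat) (p delta : R) : dirichlet_exponents lambda ->
  dirichlet_abs_cvg a lambda sigma -> a 0%N = 1 -> 0 < p -> 0 < delta ->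
  expR (- (p * (pi * ((ln (dirichlet_norm1 a lambda sigma) + ln 2) ^+ 2 / (lambda 1%N * delta) + lambda 1%N * delta)))) <=
  1 / delta * \int[lebesgue_measure]_(t in `[T, T + delta])
    (cmod (dirichlet_series a lambda (sigma +i* t)) `^ p).
Proof.
move=> hl hc ha p0 d0; set K := dirichlet_norm1 _ _ _; set E := expR _.
have K1 : 1 <= K := dirichlet_norm1_ge1 hl hc ha.
have K0 : 0 < K by rewrite (lt_le_trans _ K1).
have l1 : 0 < lambda 1%N by rewrite -(proj1 hl) (proj2 hl).
pose A := ln K + ln 2.
have A0 : 0 < A by rewrite ltr_wpDl ?ln_ge0// ln_gt0// ltr1n.
pose h := A / lambda 1%N; have h0 : 0 < h by rewrite divr_gt0.
have hE : expR (- (h * lambda 1%N)) = (2 * K)^-1.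
  by rewrite /h divfK ?gt_eqF// expRN /A expRD !lnK ?posrE// mulrC.
pose c := T + delta / 2.
pose F N t := cmod (mesh_poly sigma c a lambda N).[circle_param (mesh R N) c t].
have FK N t : F N t <= K by exact: cmod_mesh_poly_le.
have FL t : (fun N => F N t) @ \oo --> cmod (dirichlet_series a lambda (sigma +i* t)).
  exact: dirichlet_line_cvg.
pose I : set R := `[T, T + delta]%classic.
have mI : measurable I by exact: measurable_itv.
pose G t := cmod (dirichlet_series a lambda (sigma +i* t)) `^ p.
pose Fp N t := F N t `^ p.
pose Kp := K `^ p.
pose J N := \int[lebesgue_measure]_(t in I) Fp N t.
have iF N : lebesgue_measure.-integrable I (EFin \o Fp N).
  by apply: integrable_powR_cmod_poly => // t; exact: FK.
have JE N : (\int[lebesgue_measure]_(t in I) (Fp N t)%:E)%E = (J N)%:E.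
  by rewrite /J /Rintegral fineK//; exact: integrable_fin_num (iF N).
have icst : lebesgue_measure.-integrable I (EFin \o (fun=> K `^ p)).
  by apply: continuous_itv_integrable => t; exact: cvg_cst.
have F0 N t : 0 <= F N t by exact: cmod_ge0.
have FKp N t : F N t `^ p <= K `^ p.
  by rewrite ge0_ler_powR ?nnegrE ?(ltW p0) ?(ltW K0).
have up N : J N <= K `^ p * delta.
  have -> : K `^ p * delta = \int[lebesgue_measure]_(t in I) (K `^ p).
    by rewrite Rintegral_cst_itv ?lerDl ?(ltW d0)// addrC addKr.
  by apply: le_Rintegral => // t _; exact: FKp.
have low : \forall N \near \oo, E * delta <= J N.
  have [M1 _ hM1] := cvgr_le _ (cvg_mul_mesh (K * h)) _ ltr01.
  have [M2 _ hM2] := cvgr_le _ (cvg_mul_mesh delta) _ ltr01.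
  exists (maxn M1 M2).+1 => // -[//|N] /=; rewrite ltnS geq_max => /andP[m1 m2].
  have /= n1 := hM1 N.+1 (leqW m1); have /= n2 := hM2 N.+1 (leqW m2).
  have w0 : 0 < mesh R N.+1 by rewrite invr_gt0.
  have wd : mesh R N.+1 * delta <= 2 * pi.
    by rewrite mulrC (le_trans n2)//; have := pi_ge2 R; lra.
  have := polynomial_mean_lower_bound (T := T) w0 l1 K1 p0 d0 wd (FK N.+1)
    (mesh_poly_lower_bound c hl hc ha h0 hE n1).
  by rewrite div1r ler_pdivlMl// mulrC.
have lim : ((J N)%:E @[N --> \oo] -->
  \int[lebesgue_measure]_(t in I) (G t)%:E)%E.
  under eq_fun do rewrite -JE.
  apply: (@dominated_cvg _ _ _ _ _ _ _ _ (fun=> Kp%:E)) => //.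
  - by move=> N; exact: (measurable_int _ (iF N)).
  - move=> t _; apply: cvg_EFin; first exact: nearW.
    by apply: cvg_powR => // N; exact: F0.
  - move=> N t _; rewrite abse_EFin lee_fin ger0_norm ?powR_ge0//; exact: FKp.
have lo : ((E * delta)%R%:E <= \int[lebesgue_measure]_(t in I)
    (G t)%:E)%E.
  by apply: (cvge_to_ge lim); apply: filterS low => N; rewrite lee_fin.
have hi : (\int[lebesgue_measure]_(t in I)
    (G t)%:E <= (K `^ p * delta)%R%:E)%E.
  by apply: (cvge_to_le lim); apply: nearW => N; rewrite lee_fin.
rewrite div1r ler_pdivlMl// mulrC -lee_fin fineK//.
by rewrite fin_numElt (lt_le_trans _ lo) ?ltNyr// (le_lt_trans hi) ?ltry.
Qed.

Theorem theorem19 (R : realType) (sigma : R) (a : nat -> R[i]) (lambda : R^nat)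
    (hlambda : dirichlet_exponents lambda)
    (hcvg : dirichlet_abs_cvg a lambda sigma)
    (ha0 : a 0%N = 1)
    (p : R) (hp : 0 < p) (delta : R) (hdelta : 0 < delta) :
  let L := dirichlet_series a lambda in
  let normL := dirichlet_norm1 a lambda sigma in
  inf [set ((1 / delta * \int[lebesgue_measure]_(t in `[T, T + delta])
                           (cmod (L (sigma +i* t)) `^ p)) `^ (1 / p))
      | T in [set: R]]
  >= expR (- (pi * ((ln normL + ln 2) ^+ 2 / (lambda 1%N * delta)
                    + lambda 1%N * delta))).
Proof.
cbv zeta; apply: lb_le_inf; first by eexists; exists 0.
move=> _ [T _ <-]; set B := pi * _.
have -> : expR (- B) = expR (- (p * B)) `^ (1 / p).
  by rewrite -expRM; congr expR; field; rewrite lt0r_neq0.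
have p1 : 0 <= 1 / p by rewrite div1r invr_ge0 ltW.
have h := dirichlet_mean_lower_bound T hlambda hcvg ha0 hp hdelta.
by rewrite ge0_ler_powR ?nnegrE ?expR_ge0// (le_trans _ h) ?expR_ge0.
Qed.
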